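(* Let $\mathcal F$ be a class of binary predictors satisfying Axioms 1--4 and containing the predictors $\phi^0,\phi^1,\psi^1,\psi^2$ (all described in the context), with a fixed predictor hierarchy $\mathcal F_1\subset\mathcal F_2\subset\cdots$ on $\mathcal F$, and write $I(\cdot)=I(\cdot\,;\mathcal F)$. Let $a\in\{0,1\}^\infty$ with $I(a)>0$. Then for each $\gamma>0$, either at least one of the five inequalities $$I(P^{\nu}a)\ge I(a)+\gamma\quad(\nu=0,1,2),\qquad I(S^{\nu}a)\ge I(a)+\gamma\quad(\nu=1,2)$$ holds, or there exists $\tilde f\in\mathcal F$ such that both of the following relations hold: $$\limsup_{n\to\infty}E(\tilde f a;n)\ \ge\ \frac{I(a)}{4},\qquad I(\tilde f_*a)\ \ge\ \frac12-\frac{4\gamma}{I(a)}.$$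
   Context: **Predictors.** $\{0,1\}^\infty$ is the set of infinite binary sequences $a=a_0a_1a_2\ldots$, and $\oplus$ is addition mod 2 (applied termwise to sequences). A binary predictor is a map $f:\{0,1\}^\infty\to\{0,1\}^\infty$ that is causal: $(f(a))_0$ is the same for all $a$, and for each $n\ge1$, if $a_i=b_i$ for $i=0,\dots,n-1$ then $(f(a))_n=(f(b))_n$. We write $fa$ for $f(a)$. **Hierarchy and predictability.** A predictor hierarchy on a class $\mathcal F$ of predictors is an increasing sequence of nonempty finite sets $\mathcal F_1\subset\mathcal F_2\subset\cdots$ with $\bigcup_i\mathcal F_i=\mathcal F$. The predictability (also called unpredictability) of $a$ is $$I(a;\mathcal F)=\lim_{m\to\infty}\limsup_{n\to\infty}\min_{f\in\mathcal F_m}\frac1n\sum_{i=0}^{n-1}\big((f(a))_i\oplus a_i\big).$$ **Frequency.** $E(a;n)=\frac1n\sum_{i=0}^{n-1}a_i$. **Operations.** $(P^0a)_i=a_{3i}$, $(P^1a)_i=a_{3i+2}$, $(P^2a)_i=a_{3i+1}$; $(S^1a)_i=a_{3i}\oplus a_{3i+2}$, $(S^2a)_i=a_{3i+1}\oplus a_{3i+2}$, for $i\ge0$. **Selected subsequence.** For a predictor $f$, $f_*a$ is the subsequence of $a$ consisting of those $a_i$ for which $(fa)_i=1$, in increasing order of $i$, indexed from $0$. (It is an infinite sequence when $(fa)_i=1$ for infinitely many $i$.) **Axioms on $\mathcal F$.** Axiom 1 (Summation): for any $f^0,f^1\in\mathcal F$, the map $f$ with $(fa)_i=(f^0a)_i\oplus(f^1a)_i$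 is in $\mathcal F$. Axiom 2 (Interleaving): for any $f^0,f^1,f^2\in\mathcal F$, the map $f$ determined by $P^\nu fa=P^\nu f^\nu a$ for all $a$ and $\nu=0,1,2$ is in $\mathcal F$. Axiom 3 (Subsequences): for any $f\in\mathcal F$, the class $\mathcal F$ contains at least one map of each of the following types (identities for all $a$): $f^1$ with $P^1f^1a=fS^1a$; $f^2$ with $P^1f^2a=fS^2a$; $g^1$ with $P^2g^1a=fS^1a$; $g^2$ with $P^2g^2a=fS^2a$; and, for each $\nu=0,1,2$, $h^\nu$ with $P^\nu h^\nu a=fP^\nu a$. Axiom 4 (Switching): for any $f^0,f^1,f^2\in\mathcal F$, the class $\mathcal F$ contains the map $f$ given by $(fa)_i=(f^1a)_i$ if $(f^0a)_i=0$, and $(fa)_i=(f^2b)_{l(i)}$ if $(f^0a)_i=1$, where $b=f^0_*a$ and $l(i)$ is the number of indices $j<i$ with $(f^0a)_j=1$. (If $b$ is finite, $(f^2b)_{l(i)}$ is still well defined by causality, as it depends only on the first $l(i)$ terms of $b$.) **Simple predictors.** $\phi^0,\phi^1$ are the constant predictors $(\phi^0(a))_n=0$, $(\phi^1(a))_n=1$; and $(\psi^1a)_j=a_{j-2}$ for $j\ge2$, $(\psi^2a)_j=a_{j-1}$ for $j\ge1$, with some fixed values for the remaining initial indices $j$. *)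

(* Defs.v *)
From HB Require Import structures.
From mathcomp Require Import all_boot all_order all_algebra.
From mathcomp Require Import all_classical all_reals all_analysis.

Set Implicit Arguments.
Unset Strict Implicit.
Unset Printing Implicit Defensive.

Import Order.TTheory GRing.Theory Num.Theory.

Local Open Scope classical_set_scope.
Local Open Scope ring_scope.

(* Binary digits are booleans, and addition mod 2 is [addb], written (+). *)
Definition binseq : Type := nat -> bool.

Definition seqmap : Type := binseq -> binseq.

(* For n = 0 the hypothesis is vacuous, so the first output is constant. *)
Definition predictor (f : seqmap) : Prop :=
  forall (n : nat) (a b : binseq),
    (forall i, (i < n)%N -> a i = b i) -> f a n = f b n.

(* The value at n = 0 is 0. *)
Definition freq (R : realType) (a : binseq) (n : nat) : R :=
  n%:R^-1 * \sum_(i < n) (nat_of_bool (a i))%:R.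

Definition error_rate (R : realType) (f : seqmap) (a : binseq) (n : nat) : R :=
  freq R (fun i => f a i (+) a i) n.

(* Levels are indexed from 0: H m is the level numbered m + 1 when counting
   from 1. *)
Definition hierarchy (F : set seqmap) (H : nat -> set seqmap) : Prop :=
  [/\ forall m, finite_set (H m),
      forall m, H m !=set0,
      forall m, H m `<=` H m.+1
    & \bigcup_m H m = F].

(* Each H m is finite and nonempty, so the infimum is a minimum. Its values lie
   in [0, 1] and do not increase with m, so the real-valued [limn_sup] and
   [limn] are genuine limits. *)
Definition unpredictability (R : realType) (H : nat -> set seqmap)
    (a : binseq) : R :=
  limn (fun m => limn_sup (fun n => inf [set error_rate R f a n | f in H m])).

(* The indices in P1 and P2 are deliberately not in increasing order. *)
Definition P0 (a : binseq) : binseq := fun i => a (3 * i)%N.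
Definition P1 (a : binseq) : binseq := fun i => a (3 * i + 2)%N.
Definition P2 (a : binseq) : binseq := fun i => a (3 * i + 1)%N.

Definition S1 (a : binseq) : binseq :=
  fun i => a (3 * i)%N (+) a (3 * i + 2)%N.
Definition S2 (a : binseq) : binseq :=
  fun i => a (3 * i + 1)%N (+) a (3 * i + 2)%N.

(* The number of indices j < i with c j = 1. *)
Definition rank (c : binseq) (i : nat) : nat := count c (iota 0 i).

(* The index of the k-th one of c, counting from 0; it is 0 if c has at most k
   ones. *)
Definition one_index (c : binseq) (k : nat) : nat :=
  xget 0%N [set i | c i /\ rank c i = k].

(* The subsequence of the a i with f a i = 1. When there are only finitely many
   such i it is padded with copies of a 0. *)
Definition select (f : seqmap) (a : binseq) : binseq :=
  fun k => a (one_index (f a) k).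

Definition sum_map (f0 f1 : seqmap) : seqmap :=
  fun a i => f0 a i (+) f1 a i.

(* If f2 is a predictor, its output at rank (f0 a) i only depends on the first
   rank (f0 a) i terms of select f0 a, hence never on the padding. *)
Definition switch_map (f0 f1 f2 : seqmap) : seqmap :=
  fun a i => if f0 a i then f2 (select f0 a) (rank (f0 a) i) else f1 a i.

Definition summation_axiom (F : set seqmap) : Prop :=
  forall f0 f1, F f0 -> F f1 -> F (sum_map f0 f1).

(* The three identities determine f. *)
Definition interleaving_axiom (F : set seqmap) : Prop :=
  forall f0 f1 f2, F f0 -> F f1 -> F f2 ->
    exists2 f, F f & forall a,
      [/\ P0 (f a) = P0 (f0 a), P1 (f a) = P1 (f1 a) & P2 (f a) = P2 (f2 a)].

Definition subsequences_axiom (F : set seqmap) : Prop :=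
  forall f, F f ->
    (exists2 f1, F f1 & forall a, P1 (f1 a) = f (S1 a)) /\
    (exists2 f2, F f2 & forall a, P1 (f2 a) = f (S2 a)) /\
    (exists2 g1, F g1 & forall a, P2 (g1 a) = f (S1 a)) /\
    (exists2 g2, F g2 & forall a, P2 (g2 a) = f (S2 a)) /\
    (exists2 h0, F h0 & forall a, P0 (h0 a) = f (P0 a)) /\
    (exists2 h1, F h1 & forall a, P1 (h1 a) = f (P1 a)) /\
    (exists2 h2, F h2 & forall a, P2 (h2 a) = f (P2 a)).

Definition switching_axiom (F : set seqmap) : Prop :=
  forall f0 f1 f2, F f0 -> F f1 -> F f2 -> F (switch_map f0 f1 f2).

Definition phi0 : seqmap := fun _ _ => false.
Definition phi1 : seqmap := fun _ _ => true.

(* The booleans c0, c1, d0 are the fixed initial values. *)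
Definition psi1 (c0 c1 : bool) : seqmap :=
  fun a j => match j with 0 => c0 | 1 => c1 | i.+2 => a i end.
Definition psi2 (d0 : bool) : seqmap :=
  fun a j => match j with 0 => d0 | i.+1 => a i end.

(* Main.v *)
Require Import Defs.
From mathcomp Require Import all_boot all_order all_algebra.
From mathcomp Require Import all_classical all_reals all_analysis.
From mathcomp Require Import zify ring lra.

Import Order.TTheory GRing.Theory Num.Theory.

Local Open Scope classical_set_scope.
Local Open Scope ring_scope.

(** Write x, y, z for a (3 i), a (3 i + 1), a (3 i + 2), and I for the
    unpredictability of a. Suppose that predictors p0, p2, s1, s2 guess the
    sequences x, y, x (+) z, y (+) z, each with error rate at most I + gamma.
    They give two guesses of z, namely x plus the guess of x (+) z, and y plus
    the guess of y (+) z; the selecting predictor is the indicator of the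
    indices 3 i + 2 where these two guesses disagree.

    The disagreement is dense (disagreement_density). Before y is revealed, x
    plus the guesses of x (+) z and y (+) z is a guess of y, and it is wrong
    exactly when the two guesses of z disagree (predict_P2_S1_S2). Using p0 for
    x, this guess for y and s1 for z, the error rate on a, which cannot be much
    less than I, is about a third of the sum of two rates at most I + gamma and
    of the density of i with a disagreement. Hence the disagreements have
    density at least I / 3 - 2 gamma / 3 in a, and this is at least I / 4 when
    gamma <= I / 8. For gamma > I / 8 the second bound of the conclusion is
    negative, and the constant predictor 1 will do.

    The selected terms are unpredictable (rank_errs_switch, selected_error). At
    a disagreement exactly one of the two guesses of z is wrong, so together
    they err once there, that is at rate 1/2 on average. If g predicted the
    selected terms at rate 1/2 - delta, then switching to g at the
    disagreements would improve on the average of the two guesses by delta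
    times the density of the disagreements, which is at least delta * I / 4. As
    p0 on x, p2 on y and either guess on z achieve I + gamma, and nothing does
    better than I, this gain is at most gamma, so delta <= 4 gamma / I.

    The unpredictability is a limit over levels of an upper limit of minima, so
    that the best predictor of a level depends on the length n of the prefix.
    Only finitely many quadruples (p0, p2, s1, s2) are involved, and a
    pigeonhole argument (finite_best_tuple) provides one that is good at
    lengths n where all the predictors of any given level err on a at rate
    close to I or more. *)

(** * Counting ones *)

Definition errs (f : seqmap) (b : binseq) : binseq := fun i => f b i (+) b i.

Implicit Types (c d : binseq) (n : nat).

Lemma rankS c n : rank c n.+1 = (rank c n + c n)%N.
Proof. by rewrite /rank -[n.+1]addn1 iotaD count_cat /= addn0. Qed.

Lemma leq_rank c n : (rank c n <= n)%N.
Proof. by rewrite /rank -{2}(size_iota 0 n) count_size. Qed.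

Lemma leq_rank_mono c m n : (m <= n)%N -> (rank c m <= rank c n)%N.
Proof.
move=> /subnKC <-; elim: (n - m)%N => [|k IH]; first by rewrite addn0.
by rewrite addnS rankS (leq_trans IH) // leq_addr.
Qed.

Lemma eq_rank c d n : c =1 d -> rank c n = rank d n.
Proof. by move=> cd; apply: eq_count. Qed.

(** Below an index of the subsequence there are fewer ones than below a later
    one, so the rank identifies the index. *)
Lemma one_index_rank c i : c i -> one_index c (rank c i) = i.
Proof.
move=> ci; rewrite /one_index; case: xgetP => [j _ [cj rji]|/(_ i)]; last first.
  by case.
have lt_rank k l : c k -> (k < l)%N -> (rank c k < rank c l)%N.
  move=> ck /(@leq_rank_mono c); rewrite rankS ck addn1; exact.
by case: (ltngtP j i) => // [/(lt_rank j i cj)|/(lt_rank i j ci)];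
  rewrite rji ltnn.
Qed.

(** Reindexing of a count along the subsequence selected by c. *)
Lemma rank_subsequence c (v : binseq) n :
  rank (fun j => c j && v (rank c j)) n = rank v (rank c n).
Proof.
elim: n => [//|n IH]; rewrite !rankS IH; case: (c n) => /=; last by rewrite !addn0.
by rewrite addn1 rankS.
Qed.

(** The first n indices are n %/ 3 full blocks and at most two more. *)
Lemma rank_mod3 c n :
  (rank c n <= rank (P0 c) (n %/ 3) + rank (P1 c) (n %/ 3)
               + rank (P2 c) (n %/ 3) + 2)%N.
Proof.
have mul3 N : rank c (N * 3) = (rank (P0 c) N + rank (P1 c) N + rank (P2 c) N)%N.
  elim: N => [//|N IH]; rewrite mulSn !rankS IH /P0 /P1 /P2.
  by rewrite !(mulnC 3%N) addn2 addn1; lia.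
rewrite {1}(divn_eq n 3).
have := ltn_pmod n (isT : (0 < 3)%N).
case: (n %% 3)%N => [|[|[|r]]] // _; rewrite ?addnS addn0 ?rankS mul3; lia.
Qed.

(** No rounding term here: 3 i + 2 < n exactly when i < n %/ 3. *)
Lemma rank_P1 c n : P0 c =1 phi0 c -> P2 c =1 phi0 c ->
  rank c n = rank (P1 c) (n %/ 3).
Proof.
move=> c0 c2.
have mul3 N : rank c (N * 3) = rank (P1 c) N.
  elim: N => [//|N IH]; rewrite mulSn !rankS IH.
  have := c0 N; have := c2 N; rewrite /P0 /P1 /P2 /phi0.
  by rewrite !(mulnC 3%N) addn2 addn1 => -> ->; rewrite !addn0.
rewrite {1}(divn_eq n 3); have := ltn_pmod n (isT : (0 < 3)%N).
have := c0 (n %/ 3)%N; have := c2 (n %/ 3)%N; rewrite /P0 /P2 /phi0.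
rewrite (mulnC 3%N) addn1 => e2 e0.
by case: (n %% 3)%N => [|[|[|r]]] // _;
  rewrite ?addnS addn0 ?rankS mul3 ?e0 ?e2 ?addn0.
Qed.

(** Twice the number of errors of eA switched to w where eA and eB differ. Where
    they agree, twice one error is the sum of the two; where they differ, the
    two sides gain 2 w + 1 and 1 + 2 w. *)
Lemma rank_switch_xor (eA eB w : binseq) n :
  (2 * rank (fun i => if eA i (+) eB i then w i else eA i) n
     + rank (fun i => eA i (+) eB i) n
   <= rank eA n + rank eB n + 2 * rank (fun i => (eA i (+) eB i) && w i) n)%N.
Proof.
elim: n => [//|n IH]; rewrite !rankS; move: IH.
by case: (eA n) (eB n) (w n) => [] [] []; rewrite /= ; lia.
Qed.

(** * Limits superior *)

Section limits.
Context {R : realType}.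
Implicit Types (u v : R^nat) (x y : R).

Lemma freq_rank c n : freq R c n = n%:R^-1 * (rank c n)%:R.
Proof.
rewrite /freq; congr (_ * _); rewrite -natr_sum; congr _%:R.
by elim: n => [|n IH]; rewrite ?big_ord0 // big_ord_recr /= IH rankS.
Qed.

Lemma freq_itv c n : 0 <= freq R c n <= 1.
Proof.
rewrite freq_rank mulr_ge0 ?invr_ge0 ?ler0n //=.
case: n => [|n]; first by rewrite invr0 mul0r.
by rewrite mulrC ler_pdivrMr ?ltr0n // mul1r ler_nat leq_rank.
Qed.

(** Boundedness makes the real-valued upper limit meaningful: it is the infimum
    of the tail suprema. *)
Lemma limn_sup_inf u : (forall n, 0 <= u n <= 1) ->
  limn_sup u = inf (range (sups u)) /\ has_inf (range (sups u)).
Proof.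
move=> u01.
have ub : has_ubound (range u).
  by exists 1 => _ [n _ <-]; case/andP: (u01 n).
have lb : has_lbound (range u).
  by exists 0 => _ [n _ <-]; case/andP: (u01 n).
split; first by apply: cvg_lim => //; exact: cvg_sups_inf.
split; first by exists (sups u 0%N), 0%N.
exists 0 => _ [n _ <-]; rewrite /sups /=.
apply: (@le_trans _ _ (u n)); first by case/andP: (u01 n).
apply: ub_le_sup; last by exists n => /=.
by exists 1 => _ [k _ <-]; case/andP: (u01 k).
Qed.

Lemma limn_sup_lt u x : (forall n, 0 <= u n <= 1) -> limn_sup u < x ->
  exists n0, forall n, (n0 <= n)%N -> u n < x.
Proof.
move=> u01; case: (limn_sup_inf _ u01) => -> [ne _] /(inf_lt ne)[_ [n0 _ <-]] lt.
exists n0 => n le; apply: le_lt_trans lt; apply: ub_le_sup; last by exists n.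
by exists 1 => _ [k _ <-]; case/andP: (u01 k).
Qed.

Lemma limn_sup_le u x n0 : (forall n, 0 <= u n <= 1) ->
  (forall n, (n0 <= n)%N -> u n <= x) -> limn_sup u <= x.
Proof.
move=> u01 ux; case: (limn_sup_inf _ u01) => -> [_ lb].
apply: (@le_trans _ _ (sups u n0)).
  by apply: ge_inf => //; exists n0.
apply: ge_sup; first by exists (u n0), n0 => /=.
by move=> _ [n /= le <-]; exact: ux.
Qed.

Lemma limn_sup_ge u y : (forall n, 0 <= u n <= 1) ->
  (forall n0, exists2 n, (n0 <= n)%N & y <= u n) -> y <= limn_sup u.
Proof.
move=> u01 uy; rewrite leNgt; apply/negP => /(limn_sup_lt _ _ u01)[n0 lt].
by have [n /lt ltn] := uy n0; rewrite leNgt ltn.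
Qed.

Lemma le_limn_sup u v : (forall n, 0 <= u n <= 1) ->
  (forall n, 0 <= v n <= 1) -> (forall n, u n <= v n) ->
  limn_sup u <= limn_sup v.
Proof.
move=> u01 v01 uv; apply/ler_addgt0Pr => e e0.
have [||n0 lt] := limn_sup_lt v (limn_sup v + e) => //; first by rewrite ltrDl.
by apply: (limn_sup_le _ _ n0) => // n /lt /ltW; apply: le_trans.
Qed.

End limits.

(** * Hierarchies *)

(** Used to put finitely many predictors into one level of the hierarchy. *)
Lemma finite_eventually {T : Type} (A : set T) (P : T -> nat -> Prop) :
  finite_set A -> (forall t m n, (m <= n)%N -> P t m -> P t n) ->
  (forall t, A t -> exists k, P t k) -> exists k, forall t, A t -> P t k.
Proof.
elim/Pchoice: T => T in A P *; move=> /finite_seqP[s ->] mono.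
elim: s => [|t s IH] ex; first by exists 0%N.
have [|k kP] := IH; first by move=> r rs; apply: ex; rewrite /= inE rs orbT.
have [|l lP] := ex t; first by rewrite /= mem_head.
exists (maxn k l) => r; rewrite /= inE => /predU1P[->|rs].
  exact: mono (leq_maxr _ _) lP.
exact: mono (leq_maxl _ _) (kP _ rs).
Qed.

(** Otherwise each element fails from some level on, and then they all fail at
    a common level. *)
Lemma finite_pigeonhole {T : Type} (A : set T) (Q : T -> nat -> Prop) :
  finite_set A -> (forall t m n, (m <= n)%N -> Q t n -> Q t m) ->
  (forall k, exists2 t, A t & Q t k) -> exists2 t, A t & forall k, Q t k.
Proof.
move=> fA anti ex; apply: contrapT => none.
have [||k kN] := finite_eventually A (fun t k => ~ Q t k) fA.
- by move=> t m n mn Qm /(anti _ _ _ mn).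
- by move=> t At; apply/existsNP => Qt; apply: none; exists t.
by have [t At] := ex k; apply: kN.
Qed.

Section hierarchies.
Context {R : realType} {F : set seqmap} {H : nat -> set seqmap}.
Context (FH : hierarchy F H).

Lemma hierarchy_finite m : finite_set (H m). Proof. by case: FH. Qed.

Lemma hierarchy_sub m : H m `<=` F.
Proof. by case: FH => _ _ _ <- f Hf; exists m. Qed.

Lemma hierarchy_le m n : (m <= n)%N -> H m `<=` H n.
Proof.
case: FH => _ _ Hinc _ /subnKC <-; elim: (n - m)%N => [|k IH] f.
  by rewrite addn0.
by rewrite addnS => /IH /Hinc.
Qed.

Lemma finite_sub_hierarchy A : finite_set A -> A `<=` F -> exists m, A `<=` H m.
Proof.
move=> fA AF; have [||m] := finite_eventually A (fun f m => H m f) fA.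
- by move=> f m n /hierarchy_le; exact.
- by move=> f /AF; case: FH => _ _ _ <- [m _ Hm]; exists m.
by exists m.
Qed.

Let best a m n := inf [set error_rate R f a n | f in H m].

Lemma best_itv a m n : 0 <= best a m n <= 1.
Proof.
case: FH => _ /(_ m)[f Hf] _ _; apply/andP; split.
  by apply: lb_le_inf => [|_ [g _ <-]];
    [exists (error_rate R f a n), f|case/andP: (freq_itv (R := R) (errs g a) n)].
apply: (@le_trans _ _ (error_rate R f a n)); last first.
  by case/andP: (freq_itv (R := R) (errs f a) n).
apply: ge_inf; last by exists f.
by exists 0 => _ [g _ <-]; case/andP: (freq_itv (R := R) (errs g a) n).
Qed.

Lemma best_le a m n f : H m f -> best a m n <= error_rate R f a n.
Proof.
move=> Hf; apply: ge_inf; last by exists f.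
by exists 0 => _ [g _ <-]; case/andP: (freq_itv (R := R) (errs g a) n).
Qed.

Lemma best_ge a m n y : (forall f, H m f -> y <= error_rate R f a n) ->
  y <= best a m n.
Proof.
move=> le; case: FH => _ /(_ m)[f Hf] _ _.
apply: lb_le_inf; first by exists (error_rate R f a n), f.
by move=> _ [g /le ? <-].
Qed.

Lemma best_lt a m n x : best a m n < x ->
  exists2 f, H m f & error_rate R f a n < x.
Proof.
move=> lt; apply: contrapT => none; move: lt; rewrite ltNge => /negP; apply.
apply: best_ge => f Hf; rewrite leNgt; apply/negP => lt.
by apply: none; exists f.
Qed.

Lemma unpredictability_cvg a :
  nonincreasing_seq (fun m => limn_sup (best a m)) /\
  cvgn (fun m => limn_sup (best a m)).
Proof.
have ni : nonincreasing_seq (fun m => limn_sup (best a m)).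
  move=> m k mk; apply: le_limn_sup => [n|n|n]; [exact: best_itv..|].
  by apply: best_ge => f /(hierarchy_le _ _ mk) /best_le.
split=> //; apply: nonincreasing_is_cvgn => //; exists 0 => _ [m _ <-].
by apply: limn_sup_ge (best_itv a m) _ => n0; exists n0 => //;
  case/andP: (best_itv a m n0).
Qed.

(** Being below x in the limit is already witnessed at one level, by
    predictors that may change with n. *)
Lemma unpredictability_lt a x : unpredictability R H a < x ->
  exists m n0, forall n, (n0 <= n)%N ->
    exists2 f, H m f & error_rate R f a n < x.
Proof.
move=> lt; have [_ cv] := unpredictability_cvg a.
have [m ltm] : exists m, limn_sup (best a m) < x.
  apply: contrapT => none; move: lt; rewrite ltNge => /negP; apply.
  apply: limr_ge => //; apply: nearW => m; rewrite leNgt; apply/negP => ltm.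
  by apply: none; exists m.
have [n0 lt0] := limn_sup_lt _ _ (best_itv a m) ltm.
by exists m, n0 => n /lt0 /best_lt.
Qed.

(** No level is below the limit, since the upper limits decrease with m. *)
Lemma unpredictability_gt a y m n0 : y < unpredictability R H a ->
  exists2 n, (n0 <= n)%N & forall f, H m f -> y < error_rate R f a n.
Proof.
move=> lt; have [ni cv] := unpredictability_cvg a.
have {}lt : y < limn_sup (best a m).
  exact: lt_le_trans lt (nonincreasing_cvgn_ge ni cv m).
apply: contrapT => none; move: lt; rewrite ltNge => /negP; apply.
apply: (limn_sup_le _ _ n0) (best_itv a m) _ => n n0n.
rewrite leNgt; apply/negP => lt; apply: none; exists n => // f Hf.
exact: lt_le_trans lt (best_le _ _ _ _ Hf).
Qed.

Lemma unpredictability_ge a y :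
  (forall m n0, exists2 n, (n0 <= n)%N &
    forall f, H m f -> y <= error_rate R f a n) ->
  y <= unpredictability R H a.
Proof.
move=> ge; have [_ cv] := unpredictability_cvg a.
apply: limr_ge => //; apply: nearW => m.
apply: limn_sup_ge (best_itv a m) _ => n0.
by have [n n0n /best_ge] := ge m n0; exists n.
Qed.

Lemma unpredictability_itv a : 0 <= unpredictability R H a <= 1.
Proof.
apply/andP; split.
  apply: unpredictability_ge => m n0; exists n0 => // f _.
  by case/andP: (freq_itv (R := R) (errs f a) n0).
rewrite leNgt; apply/negP => /(unpredictability_gt _ _ 0 0)[n _].
case: FH => _ /(_ 0%N)[f Hf] _ _ /(_ _ Hf); rewrite ltNge => /negP; apply.
by case/andP: (freq_itv (R := R) (errs f a) n).
Qed.

End hierarchies.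

(** * Combining predictors of the subsequences *)

Section predictor_class.
Context {F : set seqmap} {c0 c1 d0 : bool}.
Context (F_sum : summation_axiom F) (F_interleave : interleaving_axiom F).
Context (F_subseq : subsequences_axiom F).
Context (F_phi0 : F phi0) (F_psi1 : F (psi1 c0 c1)) (F_psi2 : F (psi2 d0)).

(** Interleaving acts on error sequences as well, which spares later arguments
    the values of the predictors. *)
Lemma interleave_errs f0 f1 f2 : F f0 -> F f1 -> F f2 ->
  exists2 f, F f & forall a,
    [/\ P0 (errs f a) = P0 (errs f0 a), P1 (errs f a) = P1 (errs f1 a)
      & P2 (errs f a) = P2 (errs f2 a)].
Proof.
move=> F0 F1 F2; have [f Ff fP] := F_interleave _ _ _ F0 F1 F2.
exists f => // a; have [e0 e1 e2] := fP a.
split; apply/funext => i; rewrite /P0 /P1 /P2 /errs; congr (_ (+) _).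
- exact: (congr1 (fun b : binseq => b i) e0).
- exact: (congr1 (fun b : binseq => b i) e1).
- exact: (congr1 (fun b : binseq => b i) e2).
Qed.

Lemma predict_P0 p : F p ->
  exists2 f, F f & forall a, P0 (errs f a) = errs p (P0 a).
Proof.
move=> /F_subseq[_ [_ [_ [_ [[f Ff fP] _]]]]]; exists f => // a.
by apply/funext => i; rewrite /errs -fP.
Qed.

Lemma predict_P2 p : F p ->
  exists2 f, F f & forall a, P2 (errs f a) = errs p (P2 a).
Proof.
move=> /F_subseq[_ [_ [_ [_ [_ [_ [f Ff fP]]]]]]]; exists f => // a.
by apply/funext => i; rewrite /errs -fP.
Qed.

(** When a (3 i + 2) is to be guessed, psi1 reveals a (3 i), which turns a guess
    of their sum into a guess of a (3 i + 2) with the same errors. *)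
Lemma predict_P1_S1 s : F s ->
  exists2 f, F f & forall a, P1 (errs f a) = errs s (S1 a).
Proof.
move=> /F_subseq[[f Ff fP] _]; exists (sum_map f (psi1 c0 c1)); first exact: F_sum.
move=> a; apply/funext => i; rewrite /errs /sum_map -fP /P1 /S1 addn2 /=.
by rewrite addbA.
Qed.

(** The same with psi2, which reveals a (3 i + 1). *)
Lemma predict_P1_S2 s : F s ->
  exists2 f, F f & forall a, P1 (errs f a) = errs s (S2 a).
Proof.
move=> /F_subseq[_ [[f Ff fP] _]]; exists (sum_map f (psi2 d0)); first exact: F_sum.
move=> a; apply/funext => i; rewrite /errs /sum_map -fP /P1 /S2 addn2 addn1 /=.
by rewrite addbA.
Qed.

(** At 3 i + 1 the digit a (3 i) is revealed by psi2, and the two guessed sums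
    add up to a guess of a (3 i) (+) a (3 i + 1), as a (3 i + 2) cancels. The
    errors of the two summands cancel when they occur together. *)
Lemma predict_P2_S1_S2 s1 s2 : F s1 -> F s2 ->
  exists2 f, F f & forall a,
    P2 (errs f a) = (fun i => errs s1 (S1 a) i (+) errs s2 (S2 a) i).
Proof.
move=> /F_subseq[_ [_ [[g1 G1 g1P] _]]] /F_subseq[_ [_ [_ [[g2 G2 g2P] _]]]].
exists (sum_map (sum_map g1 g2) (psi2 d0)).
  by apply: F_sum => //; apply: F_sum.
move=> a; apply/funext => i.
rewrite /errs /sum_map -g1P -g2P /P2 /S1 /S2 !addn1 addn2 /=.
by case: (g1 _ _) (g2 _ _) (a _) (a _) (a _) => [] [] [] [] [].
Qed.

(** The sum of two guesses of the same digit is also the sum of their errors: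
    the predictor f is computed without the digit a (3 i + 2), yet it knows
    whether exactly one of the two guesses is wrong. *)
Lemma disagreement s1 s2 : F s1 -> F s2 ->
  exists2 f, F f & forall a,
    [/\ P0 (f a) =1 phi0 a,
        P1 (f a) = (fun i => errs s1 (S1 a) i (+) errs s2 (S2 a) i)
      & P2 (f a) =1 phi0 a].
Proof.
move=> /predict_P1_S1[f1 F1 f1P] /predict_P1_S2[f2 F2 f2P].
have [f Ff fP] := F_interleave _ _ _ F_phi0 (F_sum _ _ F1 F2) F_phi0.
exists f => // a; have [e0 e1 e2] := fP a.
split; [by rewrite e0| |by rewrite e2].
rewrite e1 -f1P -f2P; apply/funext => i; rewrite /P1 /sum_map /errs.
by rewrite addbACA addbb addbF.
Qed.

End predictor_class.

(** On the selected indices, switching errs as often as g does on the selected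
    subsequence. *)
Lemma rank_switch_select f0 f1 g a n :
  rank (fun i => f0 a i && errs (switch_map f0 f1 g) a i) n
  = rank (errs g (select f0 a)) (rank (f0 a) n).
Proof.
rewrite -rank_subsequence; apply: eq_rank => i.
case f0i: (f0 a i) => //=.
by rewrite /errs /switch_map f0i /select one_index_rank.
Qed.

Section rates.
Context {R : realType}.
Implicit Types (x y : R).

Lemma freqM c n : n%:R * freq R c n = (rank c n)%:R.
Proof.
rewrite freq_rank mulrA; case: n => [|n]; first by rewrite !mul0r.
by rewrite mulfV ?mul1r // pnatr_eq0.
Qed.

Lemma freq_ge c n x : (0 < n)%N -> x * n%:R <= (rank c n)%:R -> x <= freq R c n.
Proof.
by move=> n0 h; rewrite freq_rank mulrC ler_pdivlMr ?ltr0n.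
Qed.

Lemma rank_le_third c n x : 0 <= x -> freq R c (n %/ 3) <= x ->
  3 * (rank c (n %/ 3))%:R <= n%:R * x.
Proof.
move=> x0 fx; rewrite -freqM mulrA; apply: ler_pM => //.
- by case/andP: (freq_itv (R := R) c (n %/ 3)).
by rewrite -natrM ler_nat mulnC leq_trunc_div.
Qed.

(** Here ra counts the errors of the predictor that uses p0, the guess of y from
    the two sums, and s1; n is large enough for the rounding term 2 to be at
    most d n. *)
Lemma disagreement_density (I g d n e0 eA D ra : R) :
  0 <= n -> 2 <= d * n -> g + 3 * d <= I / 8 -> 
  (I - d) * n <= ra -> ra <= e0 + eA + D + 2 ->
  3 * e0 <= n * (I + g) -> 3 * eA <= n * (I + g) ->
  I / 4 * n <= D.
Proof.
move=> n0 dn gI h1 h2 h3 h4.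
have : (g + 3 * d) * n <= I / 8 * n by rewrite ler_wpM2r.
lra.
Qed.

(** The gain D / 2 - W of switching is at most (g' + 2 d) n, hence at most g n,
    and n <= 4 D / I turns this into a fraction of D. *)
Lemma selected_error (I g' g d n e0 e2 eA eB D W rb : R) :
  0 < I -> 0 < g -> 2 <= d * n -> g' + 3 * d <= g ->
  (I - d) * n <= rb -> 2 * rb + D <= 2 * e0 + 2 * e2 + eA + eB + 2 * W + 4 ->
  3 * e0 <= n * (I + g') -> 3 * e2 <= n * (I + g') ->
  3 * eA <= n * (I + g') -> 3 * eB <= n * (I + g') ->
  0 <= n -> I / 4 * n <= D ->
  (1 / 2 - 4 * g / I) * D <= W.
Proof.
move=> I0 g0 dn gI h1 h2 h3 h4 h5 h6 n0 hD.
have h7 : (g' + 3 * d) * n <= g * n by rewrite ler_wpM2r.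
have h8 : g * n <= 4 * g / I * D.
  have -> : g * n = 4 * g / I * (I / 4 * n) by field; rewrite gt_eqF.
  by rewrite ler_wpM2l // divr_ge0 ?mulr_ge0 // ltW.
lra.
Qed.

End rates.

(** For each n a quadruple of the right levels is good, and by pigeonhole a single
    one is good at infinitely many of the n where level k does badly on a, for
    every k. The b's stand for sequences with one term per block of three terms
    of a, hence the length n %/ 3. *)
Lemma finite_best_tuple {R : realType} {F : set seqmap} {H : nat -> set seqmap}
    (FH : hierarchy F H) (a b0 b1 b2 b3 : binseq) (x y : R) :
  unpredictability R H b0 < x -> unpredictability R H b1 < x ->
  unpredictability R H b2 < x -> unpredictability R H b3 < x ->
  y < unpredictability R H a ->
  exists f0 f1 f2 f3, [/\ F f0, F f1, F f2 & F f3] /\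
    forall k, exists2 n, (k <= n)%N &
      (forall f, H k f -> y < error_rate R f a n) /\
      [/\ error_rate R f0 b0 (n %/ 3) < x, error_rate R f1 b1 (n %/ 3) < x,
          error_rate R f2 b2 (n %/ 3) < x & error_rate R f3 b3 (n %/ 3) < x].
Proof.
move=> /(unpredictability_lt FH)[m0 [k0 good0]] /(unpredictability_lt FH)[m1 [k1 good1]].
move=> /(unpredictability_lt FH)[m2 [k2 good2]] /(unpredictability_lt FH)[m3 [k3 good3]] ya.
pose T := H m0 `*` H m1 `*` H m2 `*` H m3.
pose Q t k := exists2 n, (k <= n)%N &
  (forall f, H k f -> y < error_rate R f a n) /\
  [/\ error_rate R t.1.1.1 b0 (n %/ 3) < x, error_rate R t.1.1.2 b1 (n %/ 3) < x,
      error_rate R t.1.2 b2 (n %/ 3) < x & error_rate R t.2 b3 (n %/ 3) < x].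
have [| | |[[[f0 f1] f2] f3] [[[T0 T1] T2] T3] Qt] := finite_pigeonhole T Q.
- by rewrite /T; repeat apply: finite_setX; exact: (hierarchy_finite FH).
- move=> t m n mn [l nl [yl good]]; exists l; first exact: leq_trans nl.
  by split=> // f /(hierarchy_le FH _ _ mn) /yl.
- move=> k.
  have [n le yn] := unpredictability_gt FH _ _ k (k + 3 * (k0 + k1 + k2 + k3)) ya.
  have [kn n0 n1 n2 n3] : [/\ k <= n, k0 <= n %/ 3, k1 <= n %/ 3, k2 <= n %/ 3
      & k3 <= n %/ 3]%N by clear -le; split; lia.
  have [f0 F0 e0] := good0 _ n0; have [f1 F1 e1] := good1 _ n1.
  have [f2 F2 e2] := good2 _ n2; have [f3 F3 e3] := good3 _ n3.
  by exists (f0, f1, f2, f3); [do ! split|exists n].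
exists f0, f1, f2, f3; split; last exact: Qt.
by split; apply: (hierarchy_sub FH); eassumption.
Qed.

(** The cost of switching to g at the disagreements f0 of two guesses with errors
    eA and eB: compared with their average, half of the number of disagreements
    is replaced by the number of errors of g. All is doubled to stay in the
    integers; the final 4 is twice the rounding term of rank_mod3. *)
Lemma rank_errs_switch f0 f1 g a (eA eB : binseq) n :
  P0 (f0 a) =1 phi0 a -> P2 (f0 a) =1 phi0 a ->
  P1 (f0 a) = (fun i => eA i (+) eB i) -> P1 (errs f1 a) = eA ->
  (2 * rank (errs (switch_map f0 f1 g) a) n + rank (f0 a) n
   <= 2 * rank (P0 (errs f1 a)) (n %/ 3) + 2 * rank (P2 (errs f1 a)) (n %/ 3)
      + rank eA (n %/ 3) + rank eB (n %/ 3)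
      + 2 * rank (errs g (select f0 a)) (rank (f0 a) n) + 4)%N.
Proof.
move=> t0 t2 t1 eAE; set w := errs _ a.
have w0 : P0 w = P0 (errs f1 a).
  apply/funext => i; have := t0 i.
  by rewrite /P0 /w /errs /switch_map => ->.
have w2 : P2 w = P2 (errs f1 a).
  apply/funext => i; have := t2 i.
  by rewrite /P2 /w /errs /switch_map => ->.
have w1 : P1 w =1 (fun i => if eA i (+) eB i then P1 w i else eA i).
  move=> i; have := congr1 (fun b : binseq => b i) t1; rewrite /= => <-.
  case: ifP => // t1i; rewrite -eAE.
  by rewrite /P1 /w /errs /switch_map; move: t1i; rewrite /P1 => ->.
have W : rank (fun i => (eA i (+) eB i) && P1 w i) (n %/ 3)
    = rank (errs g (select f0 a)) (rank (f0 a) n).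
  rewrite -(rank_switch_select f0 f1) [RHS]rank_P1.
  - by apply: eq_rank => i; rewrite /P1 -/w; have <- := congr1 (fun b : binseq => b i) t1.
  - by move=> i; have := t0 i; rewrite /P0 => ->.
  - by move=> i; have := t2 i; rewrite /P2 => ->.
have := rank_mod3 w n; rewrite w0 w2 (eq_rank _ _ _ w1).
have := rank_switch_xor eA eB (P1 w) (n %/ 3); rewrite W -t1 -rank_P1 //.
by clear; lia.
Qed.

Theorem theorem5p2 (R : realType) (F : set seqmap) (H : nat -> set seqmap)
    (c0 c1 d0 : bool)
    (F_predictor : forall f, F f -> predictor f)
    (F_sum : summation_axiom F)
    (F_interleave : interleaving_axiom F)
    (F_subseq : subsequences_axiom F)
    (F_switch : switching_axiom F)
    (F_phi0 : F phi0) (F_phi1 : F phi1)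
    (F_psi1 : F (psi1 c0 c1)) (F_psi2 : F (psi2 d0))
    (FH : hierarchy F H)
    (a : binseq) (Ia_gt0 : 0 < unpredictability R H a)
    (gamma : R) (gamma_gt0 : 0 < gamma) :
  let I := unpredictability R H in
  (I (P0 a) >= I a + gamma \/
   I (P1 a) >= I a + gamma \/
   I (P2 a) >= I a + gamma \/
   I (S1 a) >= I a + gamma \/
   I (S2 a) >= I a + gamma) \/
  exists f : seqmap,
    [/\ F f,
        limn_sup (freq R (f a)) >= I a / 4
      & I (select f a) >= 1 / 2 - 4 * gamma / I a].
Proof.
move=> I.
have IE : unpredictability R H = I by [].
rewrite IE in Ia_gt0; clearbody I.
case: (lerP (I a + gamma) (I (P0 a))) => [|I0]; first by left; left.
case: (lerP (I a + gamma) (I (P2 a))) => [|I2]; first by left; do 2 right; left.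
case: (lerP (I a + gamma) (I (S1 a))) => [|IA]; first by left; do 3 right; left.
case: (lerP (I a + gamma) (I (S2 a))) => [|IB]; first by left; do 4 right.
right.
have /andP[_ Ia_le1] := unpredictability_itv (R := R) FH a; rewrite IE in Ia_le1.
case: (ltrP (I a / 8) gamma) => [gI|gI].
  (* The bound 1 / 2 - 4 gamma / I is negative. *)
  exists phi1; split=> //.
    apply: limn_sup_ge => [n|n0]; first exact: freq_itv.
    exists n0.+1; first by [].
    rewrite freq_rank.
    have -> : rank (phi1 a) n0.+1 = n0.+1.
      by rewrite /rank /phi1 count_predT size_iota.
    by rewrite mulVf ?pnatr_eq0 //; lra.
  apply: (@le_trans _ _ 0); last first.
    by rewrite -IE; case/andP: (unpredictability_itv (R := R) FH (select phi1 a)).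
  have -> : 1 / 2 - 4 * gamma / I a = 4 * (I a / 8 - gamma) / I a.
    by field; rewrite gt_eqF.
  by rewrite pmulr_lle0 ?invr_gt0 //; lra.
have [g' [d [[d0' g'0 gd] [J0 J2 JA JB]]]] : exists g' d : R,
    [/\ 0 < d, 0 <= g' & g' + 3 * d <= gamma] /\
    [/\ I (P0 a) < I a + g', I (P2 a) < I a + g',
        I (S1 a) < I a + g' & I (S2 a) < I a + g'].
  (* Strictness leaves room for d, which absorbs rounding and approximation. *)
  pose M := Num.max (I a) (Num.max (Num.max (I (P0 a)) (I (P2 a)))
    (Num.max (I (S1 a)) (I (S2 a)))).
  have M_lt : M < I a + gamma by rewrite !gt_max ltrDl gamma_gt0 I0 I2 IA IB.
  have M_ge : I a <= M by rewrite le_max lexx.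
  have M0 : I (P0 a) <= M by rewrite !le_max lexx !orbT.
  have M2 : I (P2 a) <= M by rewrite !le_max lexx !orbT.
  have MA : I (S1 a) <= M by rewrite !le_max lexx !orbT.
  have MB : I (S2 a) <= M by rewrite !le_max lexx !orbT.
  clearbody M; exists ((M - I a + gamma) / 2), ((gamma - (M - I a)) / 6).
  by split; split; lra.
rewrite -!IE in J0 J2 JA JB.
have y_lt : I a - d < unpredictability R H a by rewrite IE ltrBlDr ltrDl.
have [p0 [p2 [s1 [s2 [[Fp0 Fp2 Fs1 Fs2] good]]]]] :=
  finite_best_tuple FH a _ _ _ _ _ _ J0 J2 JA JB y_lt.
rewrite IE in good; clear I0 I2 IA IB J0 J2 JA JB y_lt.
have [f0 F0 f0P] := predict_P0 F_subseq _ Fp0.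
have [f2 F2 f2P] := predict_P2 F_subseq _ Fp2.
have [f1 F1 f1P] := predict_P1_S1 F_sum F_subseq F_psi1 _ Fs1.
have [f2' F2' f2'P] := predict_P2_S1_S2 F_sum F_subseq F_psi2 _ _ Fs1 Fs2.
have [ft Fft ftP] :=
  disagreement F_sum F_interleave F_subseq F_phi0 F_psi1 F_psi2 _ _ Fs1 Fs2.
(* On y, al uses the two guessed sums, and be uses p2. *)
have [al Fal /(_ a)[al0 al1 al2]] := interleave_errs F_interleave _ _ _ F0 F1 F2'.
have [be Fbe /(_ a)[be0 be1 be2]] := interleave_errs F_interleave _ _ _ F0 F1 F2.
have [t0 t1 t2] := ftP a.
(* At these lengths n the members of A do badly on a, and so does al, which is
   added to A to force many disagreements. *)
have frequent A n0 : finite_set A -> A `<=` F ->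
    exists2 n, (n0 <= n)%N &
      [/\ 2 <= d * n%:R,
          forall f, A f -> (I a - d) * n%:R <= (rank (errs f a) n)%:R,
          3 * (rank (errs p0 (P0 a)) (n %/ 3))%:R <= n%:R * (I a + g')
            /\ 3 * (rank (errs p2 (P2 a)) (n %/ 3))%:R <= n%:R * (I a + g'),
          3 * (rank (errs s1 (S1 a)) (n %/ 3))%:R <= n%:R * (I a + g')
            /\ 3 * (rank (errs s2 (S2 a)) (n %/ 3))%:R <= n%:R * (I a + g')
        & I a / 4 * n%:R <= (rank (ft a) n)%:R].
  move=> finA AF.
  have [||M AM] := finite_sub_hierarchy FH (A `|` [set al]).
  - by rewrite finite_setU; split=> //; exact: finite_set1.
  - by move=> f [/AF|->].
  have [n le [lb [e0 e2 eA eB]]] := good (M + n0 + Num.bound (2 / d))%N.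
  have [n0n bn] : (n0 <= n /\ Num.bound (2 / d) <= n)%N.
    by move: (Num.bound _) le => B; clear => le; split; lia.
  have lbA f : (A `|` [set al]) f -> (I a - d) * n%:R <= (rank (errs f a) n)%:R.
    move=> /AM Hf; rewrite -freqM mulrC ler_wpM2l // ltW //; apply: lb.
    by apply: (hierarchy_le FH M) Hf; rewrite -addnA leq_addr.
  have dn : 2 <= d * n%:R.
    rewrite mulrC -ler_pdivrMr // ltW //.
    apply: lt_le_trans (archi_boundP _) _; first by rewrite divr_ge0 // ltW.
    by rewrite ler_nat.
  have x0 : 0 <= I a + g' by lra.
  exists n => //.
  have h0 := rank_le_third (errs p0 (P0 a)) n _ x0 (ltW e0).
  have h2 := rank_le_third (errs p2 (P2 a)) n _ x0 (ltW e2).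
  have hA := rank_le_third (errs s1 (S1 a)) n _ x0 (ltW eA).
  have hB := rank_le_third (errs s2 (S2 a)) n _ x0 (ltW eB).
  split=> //; first by move=> f Af; apply: lbA; left.
  have := rank_mod3 (errs al a) n.
  rewrite al0 al1 al2 f0P f1P f2'P -t1 -rank_P1 // => hal.
  apply: (disagreement_density _ g' d _ _ _ _ _ _ dn _ (lbA al _) _ h0 hA) => //.
  - by lra.
  - by right.
  - by rewrite -!natrD ler_nat.
(* No competitor is needed for the density, so A is empty. *)
exists ft; split=> //.
  apply: limn_sup_ge => [n|n0]; first exact: freq_itv.
  have [|n n0n [dn _ _ _ hD]] := frequent set0 n0 (finite_set0 _); first by [].
  exists n => //; apply: freq_ge hD.
  by rewrite lt0n; apply/eqP => n00; move: dn; rewrite n00; lra.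
rewrite -IE; apply: (unpredictability_ge FH) => m k0; rewrite IE.
(* The competitors are the switches to all g of level m. The length n is taken
   large enough for at least k0 terms to be selected. *)
have [||n n0n [dn lb [h0 h2] [hA hB] hD]] :=
  frequent (switch_map ft be @` H m) (Num.bound (k0%:R / (I a / 4))).
- exact/finite_image/(hierarchy_finite FH).
- by move=> _ [g Hg <-]; apply: F_switch => //; exact: (hierarchy_sub FH) Hg.
have n_gt0 : (0 < n%:R :> R) by rewrite -(pmulr_rgt0 _ d0'); lra.
exists (rank (ft a) n).
  rewrite -(ler_nat R); apply: le_trans hD; rewrite mulrC -ler_pdivrMr; last by lra.
  rewrite ltW //; apply: lt_le_trans (archi_boundP _) _; last by rewrite ler_nat.
  by rewrite divr_ge0 //; lra.
move=> g Hg; apply: (@freq_ge _ (errs g _)).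
  by rewrite -(ltr_nat R); apply: lt_le_trans hD; rewrite mulr_gt0 //; lra.
have := rank_errs_switch ft be g a _ _ n t0 t2 t1 (etrans be1 (f1P a)).
rewrite be0 be2 f0P f2P => hbe.
have lbg : (I a - d) * n%:R <= (rank (errs (switch_map ft be g) a) n)%:R.
  by apply: lb; exists g.
apply: (selected_error _ _ _ _ _ _ _ _ _ _ _ _ Ia_gt0 gamma_gt0 dn gd lbg _
  h0 h2 hA hB _ hD) => //.
by rewrite -!natrM -!natrD ler_nat.
Qed.
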